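(* For $a>0$ let $$\lambda_a=\inf_{0\ne v\in\mathfrak D(Q_W^{\,a})}\frac{Q_W^{\,a}(v)}{\|v\|_{L^2}^2}$$ be the lowest eigenvalue of the self-adjoint operator $A_a$ on $L^2(-a,a)$ associated with the localized Weil quadratic form $Q_W^{\,a}$. Then $\lambda_a$ is a continuous function of $a\in(0,\infty)$.
   Context: All function spaces are complex; $\langle v_1,v_2\rangle_{L^2}=\int v_1\overline{v_2}\,dx$; $L^2(-a,a)$ is viewed as a closed subspace of $L^2(\mathbb R)$ by extending functions by zero. Weil functional: with $\Lambda$ the von Mangoldt function and $C_0$ the Euler--Mascheroni constant, $$W(f)=\int_{-\infty}^{\infty} f(x)(e^{x/2}+e^{-x/2})\,dx-\sum_{n\ge1}\frac{\Lambda(n)}{\sqrt n}\bigl(f(\log n)+f(-\log n)\bigr)-(\log 4\pi+C_0)f(0)-\int_0^\infty\{f(x)+f(-x)-2e^{-x/2}f(0)\}\frac{e^{x/2}\,dx}{e^x-e^{-x}}.$$ With $\widetilde v(x)=\overline{v(-x)}$ and $*$ denoting convolution, put $Q_W(v_1,v_2)=W(v_1*\widetilde{v_2})$ and $Q_W(v)=Q_W(v,v)$. For $v\in L^2(-a,a)$ the function $f=v*\widetilde v$ is continuous with compact support and $\mathrm{Re}\,f(x)\le f(0)$, so $Q_W(v)\in(-\infty,+\infty]$ is well defined. $Q_W^{\,a}$ is the restriction of $Q_W$ to $L^2(-a,a)$, with form domain $\mathfrak D(Q_W^{\,a})=\{v\in L^2(-a,a): |Q_W^{\,a}(v)|<\infty\}$.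 It is known that $Q_W^{\,a}$ is a densely defined, lower bounded, closed symmetric form. $A_a$ is the self-adjoint operator associated with it: $v\in\mathfrak D(A_a)$ with $A_av=h$ iff $v\in\mathfrak D(Q_W^{\,a})$, $h\in L^2(-a,a)$ and $Q_W^{\,a}(v,w)=\langle h,w\rangle_{L^2}$ for all $w\in\mathfrak D(Q_W^{\,a})$. It is known that the spectrum of $A_a$ is discrete, bounded below, and accumulates only at $+\infty$, so $\lambda_a$ is its lowest eigenvalue. *)

(* Defs.v *)
From HB Require Import structures.
From mathcomp Require Import all_boot all_order all_algebra.
From mathcomp Require Import all_classical all_reals all_analysis.
From mathcomp Require Import complex.

Set Implicit Arguments.
Unset Strict Implicit.
Unset Printing Implicit Defensive.

Import Order.TTheory GRing.Theory Num.Theory.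
Import numFieldNormedType.Exports.
Import numFieldTopology.Exports.

Local Open Scope classical_set_scope.
Local Open Scope ring_scope.
Local Open Scope complex_scope.

(* [primes n] is a singleton exactly when n = p ^ k with p prime and k >= 1. *)
Definition von_mangoldt (R : realType) (n : nat) : R :=
  if primes n is [:: p] then ln p%:R else 0.

Definition euler_mascheroni (R : realType) : R :=
  limn (fun n : nat => \sum_(1 <= k < n.+1) (k%:R : R)^-1 - ln (n%:R : R)).

Definition cintegral (R : realType) (f : R -> R[i]) : R[i] :=
  (\int[@lebesgue_measure R]_x complex.Re (f x))%R +i*
  (\int[@lebesgue_measure R]_x complex.Im (f x))%R.

Definition convolution (R : realType) (f g : R -> R[i]) (x : R) : R[i] :=
  cintegral (fun y => f y * g (x - y)).

Definition involution (R : realType) (v : R -> R[i]) (x : R) : R[i] :=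
  (v (- x))^*.

(* The Weil functional on real-valued functions.  Its kernels are real, so on a
   complex-valued f it is W (Re f) + i W (Im f).  The value is extended real
   because the last integral may be -oo. *)
Definition weil_functional (R : realType) (f : R -> R) : \bar R :=
  (\int[@lebesgue_measure R]_x (f x * (expR (x / 2) + expR (- (x / 2))))%:E
   - \sum_(1 <= n <oo)
       (von_mangoldt R n / Num.sqrt n%:R * (f (ln n%:R) + f (- ln n%:R)))%:E
   - ((ln (4 * pi) + euler_mascheroni R) * f 0)%:E
   - \int[@lebesgue_measure R]_(x in `]0%R, +oo[)
       ((f x + f (- x) - 2 * expR (- (x / 2)) * f 0)
          * (expR (x / 2) / (expR x - expR (- x))))%:E)%E.

(* The function f = v * v~ satisfies f (- x) = (f x)^*, so Im f is odd,
   W (Im f) = 0, and W f = W (Re f). *)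
Definition weil_form (R : realType) (v : R -> R[i]) : \bar R :=
  weil_functional (fun x => complex.Re (convolution v (involution v) x)).

Definition L2normsq (R : realType) (v : R -> R[i]) : \bar R :=
  (\int[@lebesgue_measure R]_x (complex.Re (v x) ^+ 2 + complex.Im (v x) ^+ 2)%:E)%E.

(* Representatives of the elements of L^2(-a, a), extended by zero; both
   [weil_form] and [L2normsq] only depend on the class modulo null sets. *)
Definition L2_interval (R : realType) (a : R) : set (R -> R[i]) :=
  [set v | [/\ measurable_fun setT (fun x => complex.Re (v x)),
               measurable_fun setT (fun x => complex.Im (v x)),
               (L2normsq v < +oo)%E &
               forall x, ~ (- a < x < a) -> v x = 0]].

Definition weil_form_domain (R : realType) (a : R) : set (R -> R[i]) :=
  [set v | L2_interval a v /\ weil_form v \is a fin_num].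

Definition weil_lambda (R : realType) (a : R) : R :=
  inf [set r | exists v, [/\ weil_form_domain a v, L2normsq v != 0%E &
                             r = fine (weil_form v) / fine (L2normsq v)]].

(* Main.v *)
(* Only the autocorrelation [f = Re (v * v~)] of [v] enters [Q_W (v)], with
   [f 0 = |v|^2]; put [D = f 0 - f >= 0].  Up to bounded multiples of [f 0],
   [Q_W (v)] is twice the log-energy [E = int_0^oo D (x) k (x) dx], where
   [k (x) = e^(x/2) / (e^x - e^-x) ~ 1 / (2x)] near 0, minus finitely many
   values of [f] at logarithms of prime powers.  Hence [2 E <= Q_W (v) + C f 0].

   The unitary dilation [v_t (x) = t^(-1/2) v (x / t)] maps [L^2 (-a, a)] onto
   [L^2 (-ta, ta)] and replaces [f] by [f (x / t)].  The energy changes by a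
   factor tending to 1 since [t k (tx) / k (x) -> 1].  For the other terms one
   needs a modulus of continuity for [f] that is uniform in [v]: a bound on the
   energy yields [D (h) <= 40 E / log (1 / h)], and
   [|f (x) - f (x + h)| <= |v| (2 D (h))^(1/2)].  So the Rayleigh quotients [r]
   of [v] and [r'] of [v_t] satisfy [r' <= r + eps (1 + (r + C) / 2)] uniformly
   in [v] for [t] close to 1.  Dilating from [(-a, a)] to [(-a', a')] and
   conversely compares [lambda_a] with [lambda_a'] in both directions. *)
Require Import Defs.
From mathcomp Require Import all_boot all_order all_algebra.
From mathcomp Require Import all_classical all_reals all_analysis.
From mathcomp Require Import complex measurable_realfun ring lra.

Set Implicit Arguments.
Unset Strict Implicit.
Unset Printing Implicit Defensive.

Import Order.TTheory GRing.Theory Num.Theory.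
Import numFieldNormedType.Exports.
Local Open Scope classical_set_scope.
Local Open Scope ring_scope.

(** * Affine changes of variables *)

Section affine_change_of_variables.
Context {R : realType}.
Local Notation mu := (@lebesgue_measure R).

Let affine (c b : R) : measurableTypeR R -> measurableTypeR R :=
  fun x => c * x + b.

Let measurable_affine c b : measurable_fun setT (affine c b).
Proof. exact: measurable_funD. Qed.

(** Uniqueness of Lebesgue measure: [c] times the image of [mu] under [x |-> c * x + b] agrees with
    [mu] on half-open intervals. *)
Lemma lebesgue_measure_affine (c b : R) (A : set R) : 0 < c -> measurable A ->
  mu ((fun x : R => c * x + b) @^-1` A) = (c^-1%:E * mu A)%E.
Proof.
move=> c0 mA.
pose nu := pushforward mu (affine c b).
pose m1' : {measure set (measurableTypeR R) -> \bar R} :=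
  mscale (NngNum (ltW c0)) nu.
pose m1 := m1' (measurable_affine c b).
suff -> : mu A = m1 A.
  by rewrite /m1 /m1' /mscale /= muleA -EFinM mulVf ?gt_eqF// mul1e.
apply: lebesgue_measure_unique => // _ [[x y]] _ <- /=.
rewrite /m1 /m1' /mscale /= /nu /pushforward.
have -> : affine c b @^-1` `]x, y] = `](x - b) / c, (y - b) / c]%classic.
  apply/seteqP; split => z /=; rewrite !in_itv/= /affine ltr_pdivrMr//.
    by rewrite ler_pdivlMr// ltrBlDr lerBrDr mulrC.
  by rewrite ler_pdivlMr// ltrBlDr lerBrDr mulrC.
rewrite !lebesgue_measure_itv/= !lte_fin ltr_pM2r ?invr_gt0// ltrD2r.
case: ifPn => _; last by rewrite mule0.
by rewrite -!EFinB -EFinM; congr _%:E; field; rewrite gt_eqF.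
Qed.

Lemma ge0_integral_affine (c b : R) (f : R -> \bar R) : 0 < c ->
  measurable_fun [set: R] f -> (forall x, (0 <= f x)%E) ->
  (\int[mu]_x f (c * x + b)%R = c^-1%:E * \int[mu]_x f x)%E.
Proof.
move=> c0 mf f0.
have ic0 : 0 <= c^-1 by rewrite invr_ge0 ltW.
rewrite -[RHS](@ge0_integral_mscale _ _ _ mu _ measurableT (NngNum ic0))//.
rewrite -[LHS](@ge0_integral_pushforward _ _ _ _ _ _ (measurable_affine c b)
  mu setT f)//.
apply: eq_measure_integral => //= A mA _.
exact: lebesgue_measure_affine.
Qed.

Lemma ge0_integral_shift (b : R) (f : R -> \bar R) :
  measurable_fun [set: R] f -> (forall x, (0 <= f x)%E) ->
  (\int[mu]_x f (x + b)%R = \int[mu]_x f x)%E.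
Proof.
move=> mf f0; rewrite -[RHS]mul1e -{1}invr1 -(ge0_integral_affine b)//.
by apply: eq_integral => x _; rewrite mul1r.
Qed.

Lemma ge0_integral_scale_pos (c : R) (f : R -> \bar R) : 0 < c ->
  measurable_fun (`]0, +oo[%classic : set R) f -> (forall x, 0 < x -> (0 <= f x)%E) ->
  (\int[mu]_(x in `]0%R, +oo[) f (c * x)%R =
   c^-1%:E * \int[mu]_(x in `]0%R, +oo[) f x)%E.
Proof.
move=> c0 mf f0.
rewrite integral_mkcond [in RHS]integral_mkcond -(ge0_integral_affine 0)//.
- apply: eq_integral => x _; rewrite addr0 /patch !mem_setE !in_itv/= !andbT.
  by rewrite pmulr_rgt0.
- by apply/(measurable_restrictT f _).
- by move=> x; rewrite /patch mem_setE in_itv/= andbT; case: ifPn => // /f0.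
Qed.

End affine_change_of_variables.

(** * Autocorrelations *)

Section correlation.
Context {R : realType}.
Local Notation mu := (@lebesgue_measure R).
Implicit Types u v w : R -> R.

(** A real theory is enough: a complex [v] enters only through its real and imaginary parts. *)
Definition square_integrable u : Prop :=
  measurable_fun setT u /\ mu.-integrable setT (EFin \o (fun x => u x ^+ 2)).

Definition inner u v : R := \int[mu]_x (u x * v x).

Definition translate (h : R) u : R -> R := fun x => u (x - h).

Lemma square_integrable_mul u v : square_integrable u -> square_integrable v ->
  mu.-integrable setT (EFin \o (fun x => u x * v x)).
Proof.
move=> [mu_ iu] [mv iv].
apply: le_integrable (integrableD measurableT iu iv) => //.
  exact/measurable_EFinP/measurable_funM.
move=> x _; rewrite /= lee_fin.
rewrite [leRHS]ger0_norm ?addr_ge0 ?sqr_ge0// ler_norml.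
by apply/andP; split; nra.
Qed.

Lemma square_integrableB u v : square_integrable u -> square_integrable v ->
  square_integrable (u \- v).
Proof.
move=> su sv; case: (su) => mu_ iu; case: (sv) => mv iv; split.
  exact: measurable_funB.
apply: eq_integrable (integrableB measurableT (integrableD measurableT iu iv)
  (integrableZl measurableT 2 (square_integrable_mul su sv))) => //.
by move=> x _ /=; congr _%:E; ring.
Qed.

Lemma measurable_affine (c b : R) u : measurable_fun setT u ->
  measurable_fun setT (fun x => u (c * x + b)).
Proof.
move=> mu_; apply: (measurableT_comp mu_).
by apply: measurable_funD => //; exact: measurable_funM.
Qed.

Lemma square_integrable_affine (k c b : R) u : 0 < c -> square_integrable u ->
  square_integrable (fun x => k * u (c * x + b)).
Proof.
move=> c0 [mu_ /integrableP[miu iu]]; split.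
  by apply: measurable_funM => //; exact: measurable_affine.
suff iu' : mu.-integrable setT (EFin \o (fun x => u (c * x + b) ^+ 2)).
  apply: eq_integrable (integrableZl measurableT (k ^+ 2) iu') => //.
  by move=> x _ /=; rewrite exprMn.
apply/integrableP; split.
  by apply/measurable_EFinP; apply: measurable_funX; exact: measurable_affine.
rewrite (ge0_integral_affine b c0 (f := fun x => `|(u x ^+ 2)%R%:E|%E))//.
  by rewrite lte_mul_pinfty ?lee_fin ?invr_ge0 ?(ltW c0).
exact: (measurableT_comp _ miu).
Qed.

Lemma square_integrable_translate h u : square_integrable u ->
  square_integrable (translate h u).
Proof.
move=> /(square_integrable_affine 1 (- h) ltr01).
by under eq_fun do rewrite !mul1r.
Qed.

Lemma inner_sqr_affine (c b : R) u : 0 < c -> square_integrable u ->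
  inner (fun x => u (c * x + b)) (fun x => u (c * x + b)) = c^-1 * inner u u.
Proof.
move=> c0 su; rewrite /inner /Rintegral.
rewrite (ge0_integral_affine b c0 (f := fun x => (u x * u x)%:E)).
- by rewrite fineM//; exact: integrable_fin_num (square_integrable_mul su su).
- by apply/measurable_EFinP/measurable_funM; case: su.
- by move=> x; rewrite lee_fin -expr2 sqr_ge0.
Qed.

Lemma inner_sqr_translate h u : square_integrable u ->
  inner (translate h u) (translate h u) = inner u u.
Proof.
move=> su; rewrite -[RHS]mul1r -[X in X * _]invr1 -(inner_sqr_affine (- h))//.
by apply: eq_Rintegral => x _; rewrite mul1r.
Qed.

Lemma innerC u v : inner u v = inner v u.
Proof. by apply: eq_Rintegral => x _; rewrite mulrC. Qed.

Lemma innerB u v w : square_integrable u -> square_integrable v ->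
  square_integrable w -> inner u (v \- w) = inner u v - inner u w.
Proof.
move=> su sv sw; rewrite /inner -RintegralB//; last 2 first.
- exact: square_integrable_mul.
- exact: square_integrable_mul.
by apply: eq_Rintegral => x _ /=; rewrite mulrBr.
Qed.

Lemma innerBl u v w : square_integrable u -> square_integrable v ->
  square_integrable w -> inner (v \- w) u = inner v u - inner w u.
Proof. by move=> su sv sw; rewrite innerC innerB// innerC (innerC u). Qed.

Lemma inner_sqrB u v : square_integrable u -> square_integrable v ->
  inner (u \- v) (u \- v) = inner u u + inner v v - 2 * inner u v.
Proof.
move=> su sv; rewrite innerB ?innerBl//; last exact: square_integrableB.
by rewrite (innerC v u); ring.
Qed.

(** Cauchy-Schwarz in Young's form. For fixed [s] the bound is linear in the squared norms, so it
    can be added over real and imaginary parts; [s] is optimized only at the end. *)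
Lemma normr_inner_le (s : R) u v : 0 < s ->
  square_integrable u -> square_integrable v ->
  `|inner u v| <= s * inner u u / 2 + inner v v / (2 * s).
Proof.
move=> s0 su sv.
have iZ k w : square_integrable w ->
    mu.-integrable setT (EFin \o (fun x => k * (w x * w x))).
  by move=> sw; exact: eq_integrable
    (integrableZl measurableT k (square_integrable_mul sw sw)).
have E : s * inner u u / 2 + inner v v / (2 * s) =
    \int[mu]_x (s / 2 * (u x * u x) + (2 * s)^-1 * (v x * v x)).
  rewrite RintegralD//; try exact: iZ.
  rewrite !RintegralZl//; try exact: square_integrable_mul.
  by rewrite /inner; field; rewrite gt_eqF.
rewrite E; apply: le_trans (le_normr_Rintegral _ (square_integrable_mul su sv)) _ => //.
apply: le_Rintegral => //.
- exact: (integrable_abse (square_integrable_mul su sv)).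
- exact: eq_integrable
    (integrableD measurableT (iZ (s / 2) u su) (iZ (2 * s)^-1 v sv)).
(* With [s = t ^+ 2], right side minus or plus [u x * v x] is half the square of
   [t * u x -+ t^-1 * v x]. *)
- move=> x _; have [t ts] : exists t, s = t ^+ 2.
    by exists (Num.sqrt s); rewrite sqr_sqrtr// ltW.
  have t0 : t != 0 by apply: contraTneq s0 => t0; rewrite ts t0 expr0n ltxx.
  rewrite ts ler_norml; apply/andP; split; rewrite -subr_ge0.
    rewrite [leRHS](_ : _ = 2^-1 * (t * u x + t^-1 * v x) ^+ 2); last by field.
    by rewrite mulr_ge0 ?invr_ge0 ?sqr_ge0.
  rewrite [leRHS](_ : _ = 2^-1 * (t * u x - t^-1 * v x) ^+ 2); last by field.
  by rewrite mulr_ge0 ?invr_ge0 ?sqr_ge0.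
Qed.

End correlation.

(* The only properties of the autocorrelation [f] of an element of
   [L^2(-L/2, L/2)] that the argument uses.  They are stable under sums and
   under the rescalings [x |-> f (x / t)]. *)
Record autocorrelation_like {R : realType} (L : R) (f : R -> R) : Prop := {
  acl_measurable : measurable_fun setT f;
  acl_even : forall x, f (- x) = f x;
  acl_support : forall x, L <= `|x| -> f x = 0;
  acl_bound : forall x, `|f x| <= f 0;
  acl_subadditive : forall x h,
    f 0 - f h <= 2 * (f 0 - f x) + 2 * (f 0 - f (x + h));
  acl_modulus : forall s x h, 0 < s ->
    `|f x - f (x + h)| <= s * f 0 / 2 + (f 0 - f h) / s }.

Section autocorrelation.
Context {R : realType}.
Local Notation mu := (@lebesgue_measure R).
Implicit Types u v w f g : R -> R.

Lemma autocorrelation_likeD L f g : autocorrelation_like L f ->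
  autocorrelation_like L g -> autocorrelation_like L (f \+ g).
Proof.
move=> [mf ef sf bf af cf] [mg eg sg bg ag cg]; split => /=.
- exact: measurable_funD.
- by move=> x; rewrite ef eg.
- by move=> x Lx; rewrite sf// sg// addr0.
- by move=> x; rewrite (le_trans (ler_normD _ _))// lerD.
- by move=> x h; have := af x h; have := ag x h; lra.
- move=> s x h s0; rewrite opprD addrACA (le_trans (ler_normD _ _))//.
  by rewrite (le_trans (lerD (cf s x h s0) (cg s x h s0)))// le_eqVlt; apply/orP;
    left; apply/eqP; ring.
Qed.

Lemma autocorrelation_like_scale (L t : R) f : 0 < t ->
  autocorrelation_like L f -> autocorrelation_like (t * L) (fun x => f (x / t)).
Proof.
move=> t0 [mf ef sf bf af cf]; split => /=; rewrite ?mul0r.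
- under eq_fun do rewrite -[X in f X]addr0 mulrC.
  exact: measurable_affine.
- by move=> x; rewrite mulNr ef.
- move=> x Lx; apply: sf; rewrite normrM normfV (gtr0_norm t0).
  by rewrite ler_pdivlMr// mulrC.
- by move=> x; exact: bf.
- by move=> x h; rewrite (mulrDl x h); exact: af.
- by move=> s x h s0; rewrite (mulrDl x h); exact: cf.
Qed.

Definition autocorrelation u (x : R) : R := inner u (translate x u).

Lemma translate0 u : translate 0 u = u.
Proof. by apply/funext => x; rewrite /translate subr0. Qed.

Lemma autocorrelation0 u : autocorrelation u 0 = inner u u.
Proof. by rewrite /autocorrelation translate0. Qed.

(** Expand the square; translation preserves the norm. This turns statements on [f 0 - f] into
    statements on squared norms of differences of translates. *)
Lemma autocorrelationB u x : square_integrable u ->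
  autocorrelation u 0 - autocorrelation u x =
  inner (u \- translate x u) (u \- translate x u) / 2.
Proof.
move=> su; rewrite inner_sqrB ?inner_sqr_translate//.
  by rewrite autocorrelation0 /autocorrelation; field.
exact: square_integrable_translate.
Qed.

Lemma measurable_autocorrelation u : square_integrable u ->
  measurable_fun setT (autocorrelation u).
Proof.
move=> su.
(* Rewritten this way, the parameter integral has a nonnegative integrand, so Tonelli gives
   measurability. *)
have -> : autocorrelation u = (fun x => inner u u
    - fine (fubini_F mu (fun z : R * R => ((u z.2 - u (z.2 - z.1)) ^+ 2)%:E) x) / 2).
  apply/funext => x; rewrite -[LHS](subKr (autocorrelation u 0)).
  by rewrite autocorrelationB// autocorrelation0.
apply: measurable_funB => //; apply: measurable_funM => //.
apply: (measurableT_comp (fine_measurable measurableT)) => //.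
apply: measurable_fun_fubini_tonelli_F => /=.
  apply/measurable_EFinP; apply: measurable_funX.
  case: su => mu_ _.
  apply: measurable_funB; first exact: (measurableT_comp mu_).
  by apply: (measurableT_comp mu_); exact: measurable_funB.
by move=> z; rewrite lee_fin sqr_ge0.
Qed.

Lemma inner_sqrB_le u v : square_integrable u -> square_integrable v ->
  inner (u \- v) (u \- v) <= 2 * inner u u + 2 * inner v v.
Proof.
move=> su sv; rewrite inner_sqrB//.
have := normr_inner_le ltr01 su sv; rewrite ler_norml => /andP[+ _]; lra.
Qed.

(** By [autocorrelationB], evenness is translation invariance of the norm and subadditivity is the
    squared triangle inequality. For the modulus, pair [u] with
    [translate x u \- translate (x + h) u], whose squared norm is [2 * (f 0 - f h)]. For the
    support, [y] and [y - x] cannot both lie in [(-a, a)] when [2 * a <= |x|]. *)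
Lemma autocorrelation_like_autocorrelation a u : square_integrable u ->
  (forall x, ~ (- a < x < a) -> u x = 0) ->
  autocorrelation_like (2 * a) (autocorrelation u).
Proof.
move=> su u0.
have st h : square_integrable (translate h u).
  exact: square_integrable_translate.
split.
- exact: measurable_autocorrelation.
- move=> x; rewrite -[LHS](subKr (autocorrelation u 0)).
  rewrite -[RHS](subKr (autocorrelation u 0)) !autocorrelationB//.
  congr (_ - _ / 2); rewrite -(inner_sqr_translate x); last first.
    exact: square_integrableB.
  have -> : translate x (u \- translate (- x) u) = translate x u \- u.
    by apply/funext => y; rewrite /translate /= opprK subrK.
  by apply: eq_Rintegral => y _ /=; ring.
- move=> x Lx; rewrite /autocorrelation /inner /Rintegral integral0_eq// => y _.
  have [ay|] := pselect (- a < y < a); last by move/u0 => ->; rewrite mul0r.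
  rewrite [X in _ * X]u0 ?mulr0//.
  move=> axy; move: Lx; apply/negP; rewrite -ltNge ltr_norml.
  by move: ay axy => /andP[? ?] /andP[? ?]; apply/andP; split; lra.
- move=> x; have := normr_inner_le ltr01 su (st x).
  rewrite inner_sqr_translate// autocorrelation0 /autocorrelation; lra.
- move=> x h; rewrite !autocorrelationB//.
  rewrite -(inner_sqr_translate x); last exact: square_integrableB.
  have -> : translate x (u \- translate h u) =
      (u \- translate (x + h) u) \- (u \- translate x u).
    apply/funext => y; rewrite /translate /= opprD addrA; ring.
  have := inner_sqrB_le (square_integrableB su (st (x + h)))
    (square_integrableB su (st x)).
  lra.
- move=> s x h s0; rewrite autocorrelationB// {1 2}/autocorrelation -innerB//.
  have := normr_inner_le s0 su (square_integrableB (st x) (st (x + h))).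
  suff -> : inner (translate x u \- translate (x + h) u)
     (translate x u \- translate (x + h) u) =
     inner (u \- translate h u) (u \- translate h u).
    rewrite autocorrelation0 => /le_trans; apply; rewrite le_eqVlt; apply/orP.
    by left; apply/eqP; field; rewrite gt_eqF.
  rewrite -(inner_sqr_translate x (square_integrableB su (st h))).
  by apply: eq_Rintegral => y _; rewrite /translate /= opprD addrA.
Qed.

End autocorrelation.

(** * The Weil form as a functional of the autocorrelation, and unitary dilations *)

Section weil_form_autocorrelation.
Context {R : realType}.
Local Notation mu := (@lebesgue_measure R).
Implicit Types (v : R -> R[i]) (u : R -> R).

Lemma inner_sqr_scale (k c : R) u : 0 < c -> square_integrable u ->
  inner (fun x => k * u (c * x)) (fun x => k * u (c * x)) =
  k ^+ 2 / c * inner u u.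
Proof.
move=> c0 su; rewrite mulrAC [RHS]mulrC.
have -> : k ^+ 2 * inner u u = inner (fun x => k * u x) (fun x => k * u x).
  rewrite /inner -RintegralZl//; last exact: square_integrable_mul.
  by apply: eq_Rintegral => x _ /=; ring.
have := square_integrable_affine k 0 ltr01 su.
under eq_fun do rewrite mul1r addr0.
move=> /(inner_sqr_affine 0 c0) <-.
by apply: eq_Rintegral => x _; rewrite addr0.
Qed.

Lemma square_integrable_scale (k c : R) u : 0 < c -> square_integrable u ->
  square_integrable (fun x => k * u (c * x)).
Proof.
move=> c0 /(square_integrable_affine k 0 c0).
by under eq_fun do rewrite addr0.
Qed.

(** The condition [k ^+ 2 = c] makes the scaling unitary. The change of variables above is for
    nonnegative integrands, hence the detour through squared norms by [autocorrelationB]. *)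
Lemma autocorrelation_scale (k c : R) u x : 0 < c -> k ^+ 2 = c ->
  square_integrable u ->
  autocorrelation (fun x => k * u (c * x)) x = autocorrelation u (c * x).
Proof.
move=> c0 kc su; set w := fun _ => _.
have sw : square_integrable w by exact: square_integrable_scale.
rewrite -[LHS](subKr (autocorrelation w 0)).
rewrite -[RHS](subKr (autocorrelation u 0)) !autocorrelationB//.
have kc1 : k ^+ 2 / c = 1 by rewrite kc divff ?gt_eqF.
congr (_ - _ / 2).
  by rewrite !autocorrelation0 inner_sqr_scale// kc1 mul1r.
rewrite -[RHS]mul1r -kc1 -inner_sqr_scale//; last first.
  exact/square_integrableB/square_integrable_translate.
by apply: eq_Rintegral => y _; rewrite /w /translate /= !mulrBr.
Qed.

(** This is the real part of [v * v~] at [x], as the proof of [weil_formE] shows. *)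
Definition weil_autocorrelation v (x : R) : R :=
  autocorrelation (fun y => complex.Re (v y)) x +
  autocorrelation (fun y => complex.Im (v y)) x.

Lemma L2_interval_square_integrable a v : L2_interval a v ->
  square_integrable (fun y => complex.Re (v y)) /\
  square_integrable (fun y => complex.Im (v y)).
Proof.
move=> [mr mi vlty _].
have iv : mu.-integrable setT
    (EFin \o (fun x => complex.Re (v x) ^+ 2 + complex.Im (v x) ^+ 2)).
  apply/integrableP; split.
    by apply/measurable_EFinP/measurable_funD; exact: measurable_funX.
  apply: le_lt_trans vlty; rewrite /L2normsq le_eqVlt; apply/orP; left; apply/eqP.
  by apply: eq_integral => x _ /=; rewrite ger0_norm// addr_ge0// sqr_ge0.
split; split => //; apply: le_integrable iv => //.
- exact/measurable_EFinP/measurable_funX.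
- move=> x _ /=; rewrite lee_fin !ger0_norm ?addr_ge0 ?sqr_ge0//.
  by rewrite lerDl sqr_ge0.
- exact/measurable_EFinP/measurable_funX.
- move=> x _ /=; rewrite lee_fin !ger0_norm ?addr_ge0 ?sqr_ge0//.
  by rewrite lerDr sqr_ge0.
Qed.

Lemma weil_formE a v : L2_interval a v ->
  weil_form v = weil_functional (weil_autocorrelation v).
Proof.
move=> /L2_interval_square_integrable[sr si].
rewrite /weil_form; congr weil_functional; apply/funext => x.
rewrite /weil_autocorrelation /autocorrelation /inner -RintegralD//; last 2 first.
- exact/square_integrable_mul/square_integrable_translate.
- exact/square_integrable_mul/square_integrable_translate.
rewrite /convolution /cintegral /=; apply: eq_Rintegral => y _.
rewrite /involution /translate opprB.
by case: (v y) (v (y - x)) => [p q] [r s] /=; ring.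
Qed.

Lemma L2normsqE a v : L2_interval a v ->
  L2normsq v = (weil_autocorrelation v 0)%:E.
Proof.
move=> va; have [sr si] := L2_interval_square_integrable va.
rewrite /weil_autocorrelation !autocorrelation0 /inner -RintegralD//; last 2 first.
- exact: square_integrable_mul.
- exact: square_integrable_mul.
rewrite /Rintegral fineK//.
case: va => _ _ vlty _; rewrite ge0_fin_numE//.
by apply: integral_ge0 => x _; rewrite lee_fin addr_ge0// -expr2 sqr_ge0.
Qed.

Lemma weil_autocorrelation_like a v : L2_interval a v ->
  autocorrelation_like (2 * a) (weil_autocorrelation v).
Proof.
move=> va; have [sr si] := L2_interval_square_integrable va.
case: va => _ _ _ v0.
by apply: autocorrelation_likeD;
  apply: autocorrelation_like_autocorrelation => // x /v0 ->.
Qed.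

Definition dilate (t : R) v : R -> R[i] := fun x =>
  (Num.sqrt t^-1 * complex.Re (v (t^-1 * x)) +i*
   (Num.sqrt t^-1 * complex.Im (v (t^-1 * x))))%C.

Lemma weil_autocorrelation_dilate a t v : 0 < t -> L2_interval a v ->
  weil_autocorrelation (dilate t v) = (fun x => weil_autocorrelation v (x / t)).
Proof.
move=> t0 va; have [sr si] := L2_interval_square_integrable va.
have k2 : Num.sqrt t^-1 ^+ 2 = t^-1 by rewrite sqr_sqrtr// invr_ge0 ltW.
apply/funext => x; rewrite /weil_autocorrelation mulrC.
by congr (_ + _); apply: autocorrelation_scale => //; rewrite invr_gt0.
Qed.

Lemma L2_interval_dilate a t v : 0 < t -> L2_interval a v ->
  L2_interval (t * a) (dilate t v).
Proof.
move=> t0 va; have [sr si] := L2_interval_square_integrable va.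
have it0 : 0 < t^-1 by rewrite invr_gt0.
have [mdr idr] := square_integrable_scale (Num.sqrt t^-1) it0 sr.
have [mdi idi] := square_integrable_scale (Num.sqrt t^-1) it0 si.
split => //.
- have /integrableP[_] := integrableD measurableT idr idi.
  apply: le_lt_trans; apply: ge0_le_integral => //.
  - by move=> x _; rewrite lee_fin addr_ge0// sqr_ge0.
  - by apply/measurable_EFinP/measurable_funD; apply: measurable_funX.
  - apply: measurableT_comp => //.
    by apply/measurable_EFinP/measurable_funD; apply: measurable_funX.
  - by move=> x _ /=; rewrite lee_fin ler_norm.
- case: va => _ _ _ v0 x xt; rewrite /dilate v0 ?mulr0// => xa; apply: xt.
  by move: xa; rewrite mulrC ltr_pdivlMr// ltr_pdivrMr// mulNr ![_ * t]mulrC.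
Qed.

End weil_form_autocorrelation.

(** * The archimedean kernel *)

Section weil_kernel.
Context {R : realType}.
Local Notation mu := (@lebesgue_measure R).
Implicit Types (x t h : R).

Definition weil_kernel x : R := expR (x / 2) / (expR x - expR (- x)).

(** Dividing by [expR x] leaves a decreasing numerator over an increasing denominator that lies in
    [(0, 1)] for [x > 0]. *)
Lemma weil_kernelE x :
  weil_kernel x = expR (- (x / 2)) / (1 - expR (- (2 * x))).
Proof.
rewrite /weil_kernel.
have -> : expR x - expR (- x) = expR x * (1 - expR (- (2 * x))).
  by rewrite mulrBr mulr1 -expRD; congr (_ - expR _); ring.
by rewrite invfM mulrA -expRN -expRD; congr (expR _ * _); field.
Qed.

Lemma weil_kernel_denominator_gt0 x : 0 < x -> 0 < 1 - expR (- (2 * x)).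
Proof. by move=> x0; rewrite subr_gt0 -expR0 ltr_expR oppr_lt0 mulr_gt0. Qed.

Lemma weil_kernel_gt0 x : 0 < x -> 0 < weil_kernel x.
Proof.
by move=> x0; rewrite weil_kernelE divr_gt0 ?expR_gt0// weil_kernel_denominator_gt0.
Qed.

Lemma measurable_weil_kernel :
  measurable_fun (`]0, +oo[%classic : set R) weil_kernel.
Proof.
apply: open_continuous_measurable_fun => //.
move=> x; rewrite inE/= in_itv/= andbT => x0.
have cE (c : R) : expR (c * y) @[y --> x] --> expR (c * x).
  have H : (fun y : R => c * y) y @[y --> x] --> c * x by exact: mulrl_continuous.
  exact: (cvg_comp _ _ H (@continuous_expR R _)).
have -> : weil_kernel = (fun y => expR (- 2^-1 * y) / (1 - expR (- 2 * y))).
  by apply/funext => y; rewrite weil_kernelE [y / 2]mulrC !mulNr.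
apply: cvgM; first exact: cE.
apply: cvgV; first by rewrite mulNr gt_eqF// weil_kernel_denominator_gt0.
by apply: cvgB; [exact: cvg_cst|exact: cE].
Qed.

(** Average the tangent line bounds of [expR] at [p], taken at [x] and [y]; the linear terms
    cancel. *)
Lemma expR_convex t (x y : R) : 0 <= t -> t <= 1 ->
  expR (t * x + (1 - t) * y) <= t * expR x + (1 - t) * expR y.
Proof.
move=> t0 t1; set p := t * x + _.
have H z : expR p * (1 + (z - p)) <= expR z.
  have -> : expR z = expR p * expR (z - p) by rewrite -expRD; congr expR; ring.
  by rewrite ler_pM2l ?expR_gt0// expR_ge1Dx.
have Hx := ler_wpM2l t0 (H x).
have t1' : 0 <= 1 - t by rewrite subr_ge0.
have Hy := ler_wpM2l t1' (H y).
apply: le_trans (lerD Hx Hy); rewrite le_eqVlt; apply/orP; left; apply/eqP.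
by rewrite /p; ring.
Qed.

Lemma weil_kernel_nonincreasing x h : 0 < x -> x <= h ->
  weil_kernel h <= weil_kernel x.
Proof.
move=> x0 xh; have h0 := lt_le_trans x0 xh.
rewrite !weil_kernelE ler_pM ?expR_ge0 ?invr_ge0 ?(ltW (weil_kernel_denominator_gt0 _))//.
  by rewrite ler_expR; lra.
rewrite lef_pV2 ?posrE ?weil_kernel_denominator_gt0//.
by rewrite lerB// ler_expR; lra.
Qed.

(** Convexity of [expR] between [- (2 * x)] and [0] gives [t * (1 - expR (- (2 * x))) <= 1 - expR (-
    (2 * (t * x)))]; the exponential factor accounts for the numerators. *)
Lemma weil_kernel_dilate_le1 t x : 0 < t -> t <= 1 -> 0 < x ->
  t * weil_kernel (t * x) <= expR ((1 - t) * x / 2) * weil_kernel x.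
Proof.
move=> t0 t1 x0; rewrite !weil_kernelE [leRHS]mulrA -expRD.
have -> : (1 - t) * x / 2 - x / 2 = - (t * x / 2) by field.
rewrite mulrCA; apply: ler_wpM2l; first exact: expR_ge0.
rewrite ler_pdivrMr ?weil_kernel_denominator_gt0 ?mulr_gt0//.
rewrite mulrC ler_pdivlMr ?weil_kernel_denominator_gt0//.
have := expR_convex (- (2 * x)) 0 (ltW t0) t1.
rewrite expR0 mulr0 addr0 mulr1.
have -> : t * - (2 * x) = - (2 * (t * x)) by ring.
lra.
Qed.

Lemma expR_le2 x : x <= 2^-1 -> expR x <= 2.
Proof.
move=> x2; rewrite -[expR x]invrK -expRN -[leRHS]invrK.
rewrite lef_pV2 ?posrE ?invr_gt0 ?expR_gt0//.
by have := expR_ge1Dx (- x); lra.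
Qed.

(** Up to [1] the exponential is at most [2]; beyond [1] the kernel is at most
    [2 * expR (- (x / 2))]. The growth caused by a dilation is thus absorbed by the kernel and an
    integrable tail. *)
Lemma expR4_weil_kernel x : 0 < x ->
  expR (x / 4) * weil_kernel x <= 2 * weil_kernel x + 2 * expR (- (x / 4)).
Proof.
move=> x0; have k0 := weil_kernel_gt0 x0.
have e0 := expR_gt0 (- (x / 4)).
have [x1|x1] := leP x 1.
  have : expR (x / 4) * weil_kernel x <= 2 * weil_kernel x.
    by rewrite ler_pM2r// expR_le2//; lra.
  lra.
suff : expR (x / 4) * weil_kernel x <= 2 * expR (- (x / 4)) by lra.
rewrite weil_kernelE mulrA -expRD ler_pdivrMr ?weil_kernel_denominator_gt0//.
have -> : x / 4 - x / 2 = - (x / 4) by field.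
rewrite mulrAC ler_peMl ?expR_ge0//.
suff : expR (- (2 * x)) <= 2^-1 by lra.
rewrite expRN lef_pV2 ?posrE ?expR_gt0//.
by have := expR_ge1Dx (2 * x); lra.
Qed.

(** For [t >= 1] the kernel is nonincreasing. For [t < 1] the factor [expR ((1 - t) * x / 2)] is
    interpolated with weight [2 * (1 - t)], at most [1] because [t >= 1/2]; then [expR4_weil_kernel]
    applies. *)
Lemma weil_kernel_dilate t x : 2^-1 <= t -> 0 < x ->
  t * weil_kernel (t * x) <=
  weil_kernel x + 4 * `|1 - t| * (weil_kernel x + expR (- (x / 4))).
Proof.
move=> t2 x0; have k0 := weil_kernel_gt0 x0; have e0 := expR_gt0 (- (x / 4)).
have t0 : 0 < t by lra.
have [t1|t1] := leP 1 t.
  have := weil_kernel_nonincreasing x0 (ler_peMl (ltW x0) t1).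
  by rewrite ler0_norm; [nra|lra].
have H := weil_kernel_dilate_le1 t0 (ltW t1) x0.
have : expR ((1 - t) * x / 2) <= 1 + 2 * (1 - t) * expR (x / 4).
  have t2' : 0 <= 2 * (1 - t) by lra.
  have t1' : 2 * (1 - t) <= 1 by lra.
  (* Interpolate the exponent between [0] and [x / 4]. *)
  have := expR_convex (x / 4) 0 t2' t1'.
  rewrite mulr0 addr0 expR0 mulr1.
  have -> : 2 * (1 - t) * (x / 4) = (1 - t) * x / 2 by field.
  lra.
move=> /(ler_wpM2r (ltW k0)) /(le_trans H) /le_trans; apply.
have := expR4_weil_kernel x0.
rewrite ger0_norm; last lra.
have t1' : 0 <= 2 * (1 - t) by lra.
move=> /(ler_wpM2l t1'); lra.
Qed.

(** The numerator is at least [1/2] and the denominator at most [2 * x]. This [1/x] singularity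
    produces the logarithm in [log_energy_modulus]. *)
Lemma weil_kernel_ge x : 0 < x -> x <= 1 -> (4 * x)^-1 <= weil_kernel x.
Proof.
move=> x0 x1; rewrite weil_kernelE ler_pdivlMr ?weil_kernel_denominator_gt0//.
have x4 : 0 < (4 * x)^-1 by rewrite invr_gt0; lra.
have e1 := expR_ge1Dx (- (x / 2)); have e2 := expR_ge1Dx (- (2 * x)).
apply: (@le_trans _ _ ((4 * x)^-1 * (2 * x))); first by rewrite ler_pM2l//; lra.
suff -> : (4 * x)^-1 * (2 * x) = 2^-1 by lra.
by field; rewrite gt_eqF.
Qed.

(** The point [x] is the dilate of [x + h] by [t = x / (x + h)], and [t >= 1/2] because [h <= x].
    One factor [2] comes from [1 / t], the other from [expR (h / 2)]. *)
Lemma weil_kernel_shift h x : 0 < h -> h <= 1 -> h <= x ->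
  weil_kernel x <= 4 * weil_kernel (x + h).
Proof.
move=> h0 h1 hx; have y0 : 0 < x + h by lra.
have x0 : 0 < x by lra.
have k0 := weil_kernel_gt0 x0; have k1 := weil_kernel_gt0 y0.
pose t := x / (x + h).
have ty : t * (x + h) = x by rewrite /t mulfVK// gt_eqF.
have t0 : 0 < t by rewrite divr_gt0.
have t2 : 2^-1 <= t by rewrite ler_pdivlMr//; lra.
have t1 : t <= 1 by rewrite ler_pdivrMr//; lra.
have := weil_kernel_dilate_le1 t0 t1 y0; rewrite ty.
have -> : (1 - t) * (x + h) / 2 = h / 2 by rewrite mulrBl ty; field.
have : expR (h / 2) <= 2 by apply: expR_le2; lra.
nra.
Qed.

Lemma weil_kernel_expR x : 0 < x ->
  (1 - expR (- (x / 2))) * weil_kernel x <= expR (- (x / 2)).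
Proof.
move=> x0; rewrite weil_kernelE mulrA ler_pdivrMr ?weil_kernel_denominator_gt0// mulrC.
by rewrite ler_pM2l ?expR_gt0// lerB// ler_expR; lra.
Qed.

Lemma integrable_expRN (c : R) : 0 < c ->
  mu.-integrable `]0, +oo[ (EFin \o (fun x => expR (- (c * x)))).
Proof.
move=> c0.
have mI : measurable (`]0, +oo[%classic : set (measurableTypeR R)) by [].
have := integrableS measurableT mI (@subsetT _ _) (integrable_exponential_pdf c0).
move=> /(integrableZl mI c^-1).
apply: eq_integrable => //.
move=> x; rewrite inE/= in_itv/= andbT => x0.
by rewrite /= exponential_pdfE ?ltW//=; congr _%:E; rewrite mulKf ?gt_eqF// mulNr.
Qed.

End weil_kernel.

(** * The Weil functional *)

Section weil_functional_decomposition.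
Context {R : realType}.
Local Notation mu := (@lebesgue_measure R).
Implicit Types (f g : R -> R) (L C : R).

Definition log_energy f : \bar R :=
  (\int[mu]_(x in `]0%R, +oo[) ((f 0 - f x) * weil_kernel x)%:E)%E.

(** In the explicit formula, the contribution of the poles of the completed zeta function at [0] and
    [1]. *)
Definition pole_term f : R :=
  \int[mu]_x (f x * (expR (x / 2) + expR (- (x / 2)))).

Definition prime_term (N : nat) f : R :=
  \sum_(1 <= n < N)
    von_mangoldt R n / Num.sqrt n%:R * (f (ln n%:R) + f (- ln n%:R)).

(** For even [f], the numerator [f x + f (- x) - 2 * expR (- (x / 2)) * f 0] is
    [2 * f 0 * (1 - expR (- (x / 2)))] minus [2 * (f 0 - f x)]. The first part gives this constant,
    the second the log-energy. *)
Definition archimedean_constant : R :=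
  \int[mu]_(x in `]0%R, +oo[) ((1 - expR (- (x / 2))) * weil_kernel x).

Lemma expR_half_le L x : `|x| <= L ->
  expR (x / 2) + expR (- (x / 2)) <= 2 * expR (L / 2).
Proof.
move=> xL; have := ler_normlP _ _ xL => -[xL1 xL2].
have : expR (x / 2) <= expR (L / 2) by rewrite ler_expR; lra.
have : expR (- (x / 2)) <= expR (L / 2) by rewrite ler_expR; lra.
lra.
Qed.

(** Stated for bounded functions of compact support so that it also covers the difference of an
    autocorrelation and its dilate. *)
Lemma pole_termP L C f : measurable_fun setT f ->
  (forall x, `|f x| <= C) -> (forall x, L <= `|x| -> f x = 0) -> 0 <= L ->
  mu.-integrable setT
    (EFin \o (fun x => f x * (expR (x / 2) + expR (- (x / 2))))) /\
  `|pole_term f| <= C * (4 * L * expR (L / 2)).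
Proof.
move=> mf fC fL L0; have C0 : 0 <= C := le_trans (normr_ge0 _) (fC 0).
pose M : R := C * (2 * expR (L / 2)).
have M0 : 0 <= M by rewrite !mulr_ge0// expR_ge0.
have iI := integrable_indic_itv (- L) L true false.
have iM : mu.-integrable setT
    (EFin \o (fun x : R => M * \1_(`[- L, L]%classic : set R) x)).
  exact: eq_integrable (integrableZl measurableT M iI).
have bM x : `|f x * (expR (x / 2) + expR (- (x / 2)))| <=
    M * \1_(`[- L, L]%classic : set R) x.
  have [xL|Lx] := leP `|x| L; last first.
    by rewrite fL ?mul0r ?normr0 ?mulr_ge0// ltW.
  rewrite indicE mem_set ?mulr1; last first.
    by rewrite /= in_itv/= -ler_norml.
  have w0 : 0 <= expR (x / 2) + expR (- (x / 2)) by rewrite addr_ge0// expR_ge0.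
  by rewrite normrM (ger0_norm w0) ler_pM// expR_half_le.
have ifw : mu.-integrable setT
    (EFin \o (fun x => f x * (expR (x / 2) + expR (- (x / 2))))).
  apply: le_integrable iM => //.
    apply/measurable_EFinP/measurable_funM => //; apply: measurable_funD.
      by apply: (measurableT_comp (@measurable_expR R)); exact: measurable_funM.
    apply: (measurableT_comp (@measurable_expR R)).
    by apply: measurable_funN; exact: measurable_funM.
  by move=> x _ /=; rewrite lee_fin (le_trans (bM x))// ler_norm.
split => //; apply: le_trans (le_normr_Rintegral _ ifw) _ => //.
apply: (@le_trans _ _ (\int[mu]_x (M * \1_(`[- L, L]%classic : set R) x))).
  by apply: le_Rintegral => //; exact: (integrable_abse ifw).
rewrite RintegralZl// /Rintegral integral_indic// setIT /= lebesgue_measure_itv/=.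
rewrite lte_fin; case: ifPn => _ /=; rewrite /M; last first.
  by rewrite mulr0 !mulr_ge0// expR_ge0.
by rewrite le_eqVlt; apply/orP; left; apply/eqP; ring.
Qed.

Lemma acl_ge0 L f : autocorrelation_like L f -> 0 <= f 0.
Proof. by move=> fL; exact: le_trans (acl_bound fL 0). Qed.

Lemma acl_le L f x : autocorrelation_like L f -> f x <= f 0.
Proof. by move=> fL; exact: le_trans (ler_norm _) (acl_bound fL x). Qed.

Lemma pole_integral L f : autocorrelation_like L f -> 0 <= L ->
  (\int[mu]_x (f x * (expR (x / 2) + expR (- (x / 2))))%:E)%E = (pole_term f)%:E.
Proof.
move=> fL L0.
have [ifw _] := pole_termP (acl_measurable fL) (acl_bound fL) (acl_support fL) L0.
by rewrite /pole_term /Rintegral fineK//; exact: integrable_fin_num ifw.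
Qed.

(** From [n = N] on, [ln n >= L] lies outside the support of [f], so the partial sums are
    stationary. *)
Lemma prime_series (N : nat) L f : autocorrelation_like L f -> expR L <= N%:R ->
  (\sum_(1 <= n <oo)
    (von_mangoldt R n / Num.sqrt n%:R * (f (ln n%:R) + f (- ln n%:R)))%:E)%E =
  (prime_term N f)%:E.
Proof.
move=> fL LN; apply: lim_near_cst => //; near=> m.
have Nm : (N <= m)%N by near: m; exact: nbhs_infty_ge.
rewrite /prime_term.
have N1 : (1 <= N)%N.
  by rewrite -(ltr_nat R); apply: lt_le_trans LN; exact: expR_gt0.
rewrite sumEFin; congr _%:E.
rewrite (big_cat_nat _ Nm)//= [X in _ + X]big_nat_cond [X in _ + X]big1 ?addr0//.
move=> n /andP[/andP[Nn _] _].
have Ln : L <= ln n%:R.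
  have Nn' : expR L <= n%:R by apply: le_trans LN _; rewrite ler_nat.
  by rewrite -[L]expRK ler_ln ?posrE ?expR_gt0// (lt_le_trans (expR_gt0 L)).
have Ln' : L <= `|ln (n%:R : R)| by rewrite (le_trans Ln)// ler_norm.
by rewrite !(acl_support fL) ?normrN// addr0 mulr0.
Unshelve. all: by end_near. Qed.

Lemma prime_term_le (N : nat) f g C : (forall x, `|f x - g x| <= C) ->
  `|prime_term N f - prime_term N g| <=
  C * \sum_(1 <= n < N) 2 * `|von_mangoldt R n / Num.sqrt n%:R|.
Proof.
move=> fgC; rewrite /prime_term -sumrB mulr_sumr.
apply: le_trans (ler_norm_sum _ _ _) _; apply: ler_sum => n _.
rewrite -mulrBr normrM mulrCA [leRHS]mulrA [leRHS]mulrC.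
rewrite [_ * `|_|]mulrC mulrC; apply: ler_wpM2l => //.
have := fgC (ln n%:R); have := fgC (- ln n%:R).
rewrite !ler_norml => /andP[? ?] /andP[? ?]; apply/andP; split; lra.
Qed.

Lemma measurable_log_energy f : measurable_fun setT f ->
  measurable_fun (`]0, +oo[%classic : set R)
    (fun x => ((f 0 - f x) * weil_kernel x)%:E).
Proof.
move=> mf; apply/measurable_EFinP/measurable_funM.
  by apply: measurable_funB => //; exact: measurable_funTS.
exact: measurable_weil_kernel.
Qed.

Lemma log_energy_ge0 L f : autocorrelation_like L f -> (0 <= log_energy f)%E.
Proof.
move=> fL; apply: integral_ge0 => x; rewrite /= in_itv/= andbT => x0.
by rewrite lee_fin mulr_ge0 ?(ltW (weil_kernel_gt0 _))// subr_ge0 (acl_le _ fL).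
Qed.

Lemma log_energyP L f : autocorrelation_like L f ->
  (log_energy f < +oo)%E <-> mu.-integrable `]0, +oo[
    (EFin \o (fun x => (f 0 - f x) * weil_kernel x)).
Proof.
move=> fL.
have E : log_energy f = (\int[mu]_(x in `]0%R, +oo[)
    `|(EFin \o (fun x => ((f 0 - f x) * weil_kernel x)%R)) x|)%E.
  apply: eq_integral => x; rewrite inE/= in_itv/= andbT => x0.
  rewrite ger0_norm//.
  by rewrite mulr_ge0 ?(ltW (weil_kernel_gt0 _))// subr_ge0 (acl_le _ fL).
rewrite E; split => [foo|/integrableP[]//]; apply/integrableP; split => //.
exact: measurable_log_energy (acl_measurable fL).
Qed.

Lemma integrable_archimedean_constant : mu.-integrable `]0, +oo[
  (EFin \o (fun x : R => (1 - expR (- (x / 2))) * weil_kernel x)).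
Proof.
have c0 : 0 < 2^-1 :> R by rewrite invr_gt0.
apply: le_integrable (integrable_expRN c0) => //.
  apply/measurable_EFinP/measurable_funM; last exact: measurable_weil_kernel.
  apply: measurable_funTS; apply: measurable_funB => //.
  apply: (measurableT_comp (@measurable_expR R)).
  by apply: measurable_funN; exact: measurable_funM.
move=> x; rewrite /= in_itv/= andbT => x0; rewrite lee_fin !ger0_norm ?expR_ge0//.
  by rewrite [_^-1 * _]mulrC weil_kernel_expR.
rewrite mulr_ge0 ?(ltW (weil_kernel_gt0 _))// subr_ge0 -[leRHS]expR0 ler_expR; lra.
Qed.

(** The integrand is [a - 2 * b] with [a] integrable and [b] the nonnegative energy density, so only
    [b] decides finiteness. *)
Lemma archimedean_term L f : autocorrelation_like L f ->
  let I := (\int[mu]_(x in `]0%R, +oo[)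
       ((f x + f (- x) - 2 * expR (- (x / 2)) * f 0)
          * (expR (x / 2) / (expR x - expR (- x))))%:E)%E in
  (I \is a fin_num <-> (log_energy f < +oo)%E) /\
  ((log_energy f < +oo)%E ->
    I = (2 * archimedean_constant * f 0 - 2 * fine (log_energy f))%:E).
Proof.
move=> fL I.
have mI : measurable (`]0, +oo[%classic : set (measurableTypeR R)) by [].
pose a x := 2 * f 0 * ((1 - expR (- (x / 2))) * weil_kernel x).
pose b x := (f 0 - f x) * weil_kernel x.
have ia : mu.-integrable `]0, +oo[ (EFin \o a).
  exact: eq_integrable (integrableZl mI (2 * f 0) integrable_archimedean_constant).
have IE : I = (\int[mu]_(x in `]0%R, +oo[) (a x - 2 * b x)%:E)%E.
  apply: eq_integral => x _; congr _%:E.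
  by rewrite /a /b (acl_even fL) /weil_kernel; ring.
have mab : measurable_fun (`]0, +oo[%classic : set (measurableTypeR R))
    (fun x => a x - 2 * b x).
  apply: measurable_funB.
    by have /measurable_int/measurable_EFinP := ia.
  apply: measurable_funM => //; apply/measurable_EFinP.
  exact: measurable_log_energy (acl_measurable fL).
split; first split.
- rewrite IE -(integral_fin_num_abs mu mI mab) => foo; apply/(log_energyP fL).
  have iab : mu.-integrable `]0, +oo[ (EFin \o (fun x => a x - 2 * b x)).
    by apply/integrableP; split => //; exact/measurable_EFinP.
  (* Recovers [b] as half of [a - (a - 2 * b)]. *)
  have := integrableZl mI 2^-1 (integrableB mI ia iab).
  apply: eq_integrable => // x _ /=; congr _%:E; rewrite /b; by field.
- move=> /(log_energyP fL) ib; rewrite IE.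
  apply: (@integrable_fin_num _ _ _ _ _ mI (EFin \o (fun x => a x - 2 * b x))).
  by have := integrableB mI ia (integrableZl mI 2 ib); exact: eq_integrable.
- move=> foo; have /(log_energyP fL) ib := foo.
  have i2b : mu.-integrable `]0, +oo[ (EFin \o (fun x => 2 * b x)).
    exact: eq_integrable (integrableZl mI 2 ib).
  rewrite IE (integralB_EFin mI ia i2b).
  have -> : (\int[mu]_(x in `]0%R, +oo[) (EFin \o a) x =
      (2 * archimedean_constant * f 0)%:E)%E.
    rewrite -[LHS]fineK; last exact: integrable_fin_num ia.
    congr _%:E; rewrite -[LHS]/(\int[mu]_(x in `]0, +oo[) a x) RintegralZl//.
      by rewrite /archimedean_constant; ring.
    exact: integrable_archimedean_constant.
  have -> : (\int[mu]_(x in `]0%R, +oo[) (2 * b x)%:E =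
      (2 * fine (log_energy f))%:E)%E.
    rewrite -[LHS]fineK; last exact: integrable_fin_num i2b.
    by congr _%:E; rewrite -[LHS]/(\int[mu]_(x in `]0, +oo[) (2 * b x)) RintegralZl.
  by rewrite EFinB.
Qed.

Definition weil_constant : R :=
  ln (4 * pi) + euler_mascheroni R + 2 * archimedean_constant.

(** The pole, prime and [f 0] terms are real numbers, so the archimedean integral alone can be
    infinite. *)
Lemma weil_functional_fin_num L f : autocorrelation_like L f -> 0 <= L ->
  weil_functional f \is a fin_num <-> (log_energy f < +oo)%E.
Proof.
move=> fL L0; have [<- _] := archimedean_term fL.
rewrite /weil_functional (pole_integral fL L0).
have [N LN] : exists N : nat, expR L <= N%:R.
  by exists (Num.bound (expR L)); rewrite ltW// archi_boundP// expR_ge0.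
rewrite (prime_series fL LN).
by rewrite !fin_numB.
Qed.

Lemma weil_functionalE (N : nat) L f : autocorrelation_like L f -> 0 <= L ->
  expR L <= N%:R -> (log_energy f < +oo)%E ->
  fine (weil_functional f) =
  pole_term f - prime_term N f - weil_constant * f 0 + 2 * fine (log_energy f).
Proof.
move=> fL L0 LN foo; have [_ /(_ foo) AE] := archimedean_term fL.
rewrite /weil_functional (pole_integral fL L0) (prime_series fL LN) AE /=.
by rewrite /weil_constant; ring.
Qed.

End weil_functional_decomposition.

(** * Modulus of continuity and dilations *)

Section modulus_of_continuity.
Context {R : realType}.
Local Notation mu := (@lebesgue_measure R).
Implicit Types (f g : R -> R) (L t h e : R).

Lemma integral_inv h : 0 < h -> h < 1 ->
  (\int[mu]_(x in `[h, 1%R]) (x^-1)%:E = (- ln h)%:E)%E.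
Proof.
move=> h0 h1; have pos x : h <= x -> 0 < x by exact: lt_le_trans.
rewrite (@continuous_FTC2 _ (fun x : R => x^-1) (@ln R))//.
- by rewrite ln1 sub0e.
- apply: continuous_in_subspaceT => x.
  rewrite inE/= in_itv/= => /andP[/pos x0 _].
  by apply: inv_continuous; rewrite gt_eqF.
- split.
  + by move=> x; rewrite in_itv/= => /andP[/ltW/pos x0 _];
      apply: ex_derive; exact: is_derive1_ln.
  + by apply: cvg_at_right_filter; exact: continuous_ln.
  + by apply: cvg_at_left_filter; exact: continuous_ln.
- move=> x; rewrite in_itv/= => /andP[/ltW/pos x0 _].
  by rewrite derive1E; apply: derive_val; exact: is_derive1_ln.
Qed.

(* By subadditivity, [D h <= 2 D x + 2 D (x + h)] for [D := f 0 - f]; integrate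
   this against [dx / (4x)] over [h <= x <= 1]. *)
Lemma log_energy_modulus L f h : autocorrelation_like L f -> 0 < h -> h < 1 ->
  (((f 0 - f h) * - ln h)%:E <= 40%:E * log_energy f)%E.
Proof.
move=> fL h0 h1.
have mf := acl_measurable fL.
have D0 x : 0 <= f 0 - f x by rewrite subr_ge0 (acl_le _ fL).
have mI : measurable (`[h, 1]%classic : set (measurableTypeR R)) by [].
have sub : (`[h, 1]%classic : set R) `<=` `]0, +oo[%classic.
  by move=> x /=; rewrite !in_itv/= andbT => /andP[/(lt_le_trans h0)].
pose G x : \bar R := ((f 0 - f x) * weil_kernel x)%:E.
(* Extension by zero to the whole line makes [ge0_integral_shift] applicable to the term in
   [x + h]. *)
pose G0 := G \_ (`]0, +oo[%classic : set R).
have G00 x : (0 <= G0 x)%E.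
  rewrite /G0 /patch mem_setE in_itv/= andbT; case: ifPn => // x0.
  by rewrite lee_fin mulr_ge0// ltW// weil_kernel_gt0.
have mG0 : measurable_fun setT G0.
  by apply/(measurable_restrictT G _) => //; exact: measurable_log_energy.
have G0E x : 0 < x -> G0 x = G x.
  by move=> x0; rewrite /G0 /patch mem_setE in_itv/= x0.
have EG : log_energy f = (\int[mu]_x G0 x)%E.
  by rewrite /log_energy integral_mkcond.
have mG0h : measurable_fun [set: R] (fun x : R => G0 (x + h)).
  by apply: (measurableT_comp mG0); exact: measurable_funD.
have minv : measurable_fun (`[h, 1]%classic : set (measurableTypeR R))
    (fun x : R => (x^-1)%:E).
  apply/measurable_EFinP; apply: subspace_continuous_measurable_fun => //.
  apply: continuous_in_subspaceT => x; rewrite inE/= in_itv/= => /andP[hx _].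
  by apply: inv_continuous; rewrite gt_eqF// (lt_le_trans h0).
have -> : (((f 0 - f h) * - ln h)%:E =
    4%:E * \int[mu]_(x in `[h, 1%R]) ((f 0 - f h) / 4 * x^-1)%:E)%E.
  under eq_integral do rewrite EFinM.
  rewrite ge0_integralZl//; last 2 first.
  - move=> x /sub; rewrite /= in_itv/= andbT => x0.
    by rewrite lee_fin invr_ge0 ltW.
  - by rewrite lee_fin divr_ge0.
  by rewrite integral_inv// -!EFinM; congr _%:E; field.
(* The [4] comes from [1 / (4x) <= k (x)]. The [10] is [2 + 8]: subadditivity gives twice the
   densities at [x] and [x + h], and [weil_kernel_shift] costs [4] on the second. *)
rewrite (_ : 40%:E = 4%:E * 10%:E)%E; last by rewrite -EFinM; congr _%:E; ring.
rewrite -muleA; apply: lee_wpmul2l => //.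
apply: (@le_trans _ _ (\int[mu]_(x in `[h, 1%R])
    (2%:E * G0 x + 8%:E * G0 (x + h)%R))%E).
  apply: ge0_le_integral => //.
  - move=> x /sub; rewrite /= in_itv/= andbT => x0.
    by rewrite lee_fin mulr_ge0 ?divr_ge0// invr_ge0 ltW.
  - by apply/measurable_EFinP; apply: measurable_funM => //; apply/measurable_EFinP.
  - by apply: emeasurable_funD; apply: measurable_funeM; exact: measurable_funTS.
  - move=> x /= xI; have := sub _ xI; rewrite /= in_itv/= andbT => x0.
    move: xI; rewrite in_itv/= => /andP[hx x1].
    have xh0 : 0 < x + h by lra.
    rewrite !G0E// /G -!EFinM -EFinD lee_fin.
    have k1 := weil_kernel_ge x0 x1.
    have k2 := weil_kernel_shift h0 (ltW h1) hx.
    have k0 := weil_kernel_gt0 x0.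
    apply: (@le_trans _ _ ((f 0 - f h) * weil_kernel x)).
      by rewrite -mulrA -invfM ler_wpM2l.
    have := acl_subadditive fL x h.
    have := D0 x; have := D0 (x + h); nra.
rewrite ge0_integralD//; last 4 first.
- by move=> x _; rewrite mule_ge0.
- by apply: measurable_funeM; exact: measurable_funTS.
- by move=> x _; rewrite mule_ge0.
- by apply: measurable_funeM; exact: measurable_funTS.
rewrite ge0_integralZl//; last exact: measurable_funTS.
rewrite ge0_integralZl//; last exact: measurable_funTS.
rewrite (_ : 10%:E = 2%:E + 8%:E)%E; last by rewrite -EFinD; congr _%:E; ring.
rewrite ge0_muleDl// EG; apply: leeD; apply: lee_wpmul2l => //.
  by apply: ge0_subset_integral.
rewrite -(ge0_integral_shift h mG0 G00).
by apply: ge0_subset_integral.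
Qed.

(** The radius [d] depends on [e] alone: functions of bounded [f 0] and energy are
    equicontinuous. *)
Lemma log_energy_uniform_modulus e : 0 < e -> exists2 d, 0 < d &
  forall L f x h, autocorrelation_like L f -> (log_energy f < +oo)%E ->
  `|h| <= d -> `|f x - f (x + h)| <= e * (f 0 + fine (log_energy f)).
Proof.
(* For [|h| <= expR (- M)], the logarithmic modulus gives [f 0 - f h <= e ^+ 2 * E] with [E] the
   energy; [acl_modulus] with [s = e] then yields the claim. *)
move=> e0; pose M := 40 / e ^+ 2.
have M0 : 0 < M by rewrite divr_gt0// exprn_gt0.
exists (expR (- M)); first exact: expR_gt0.
move=> L f x h fL foo hd.
have E0 : 0 <= fine (log_energy f) by rewrite fine_ge0// (log_energy_ge0 fL).
have f0 := acl_ge0 fL.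
have H : f 0 - f h <= e ^+ 2 * fine (log_energy f).
  have -> : f h = f `|h|.
    by case: (ger0P h) => // _; rewrite (acl_even fL).
  have [h0|h0] := leP `|h| 0.
    have -> : `|h| = 0 by apply/eqP; rewrite eq_le h0/=.
    by rewrite subrr mulr_ge0// sqr_ge0.
  have h1 : `|h| < 1.
    by rewrite (le_lt_trans hd)// -[ltRHS]expR0 ltr_expR; lra.
  have := log_energy_modulus fL h0 h1.
  rewrite -(fineK (x := log_energy f)); last first.
    by rewrite ge0_fin_numE// (log_energy_ge0 fL).
  rewrite -EFinM lee_fin => H.
  have lnh : M <= - ln `|h|.
    by rewrite lerNr -[leRHS]expRK ler_ln ?posrE ?expR_gt0.
  have D0 : 0 <= f 0 - f `|h| by rewrite subr_ge0 (acl_le _ fL).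
  have := le_trans (ler_wpM2l D0 lnh) H.
  rewrite /M mulrA ler_pdivrMr ?exprn_gt0//; nra.
apply: le_trans (acl_modulus fL x h e0) _.
have : (f 0 - f h) / e <= e * fine (log_energy f).
  by rewrite ler_pdivrMr// (le_trans H)// expr2 mulrAC.
have : 0 <= e * f 0 by rewrite mulr_ge0// ltW.
lra.
Qed.

End modulus_of_continuity.

(** * Behaviour of the log-energy under dilation *)

Section dilation.
Context {R : realType}.
Local Notation mu := (@lebesgue_measure R).
Implicit Types (f g : R -> R) (L t e : R).

(** The total mass, equal to [4], of the exponential error in [weil_kernel_dilate]. *)
Definition dilation_constant : R :=
  \int[mu]_(x in `]0%R, +oo[) expR (- (4^-1 * x)).

Lemma dilation_constant_ge0 : 0 <= dilation_constant.
Proof. by apply: Rintegral_ge0 => x _; exact: expR_ge0. Qed.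

(** Substituting [t * x] for [x] moves the dilation from [f] to the kernel. Then
    [weil_kernel_dilate] is integrated against [f 0 - f x], which is at most [2 * f 0] in the
    exponential term. *)
Lemma log_energy_dilate L f t : autocorrelation_like L f -> 2^-1 <= t ->
  (log_energy f < +oo)%E ->
  (log_energy (fun x => f (x / t)%R) <= (fine (log_energy f) + 4 * `|1 - t| *
    (fine (log_energy f) + 2 * f 0 * dilation_constant))%:E)%E.
Proof.
move=> fL t2 foo; have t0 : 0 < t by lra.
have mI : measurable (`]0, +oo[%classic : set (measurableTypeR R)) by [].
have D0 x : 0 <= f 0 - f x by rewrite subr_ge0 (acl_le _ fL).
have ftL := autocorrelation_like_scale t0 fL.
pose ft x := f (x / t).
have mft := measurable_log_energy (acl_measurable ftL).
have mkt : measurable_fun (`]0, +oo[%classic : set R) (fun x => weil_kernel (t * x)).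
  apply: (@measurable_comp _ _ _ _ _ _ (`]0, +oo[%classic : set R) weil_kernel
    (`]0, +oo[%classic : set R) (fun x => t * x)) => //.
  - by move=> _ /= [x + <-]; rewrite !in_itv/= !andbT => /(mulr_gt0 t0).
  - exact: measurable_weil_kernel.
  - exact: measurable_funM.
have c4 : 0 < 4^-1 :> R by rewrite invr_gt0.
have ie := integrable_expRN c4.
have /(log_energyP fL) ib := foo.
pose b x := (f 0 - f x) * weil_kernel x.
pose d x := 2 * f 0 * expR (- (4^-1 * x)).
have id : mu.-integrable `]0, +oo[ (EFin \o d).
  exact: eq_integrable (integrableZl mI (2 * f 0) ie).
pose s := 4 * `|1 - t|.
have s0 : 0 <= s by rewrite mulr_ge0.
have H : log_energy ft =
    (\int[mu]_(x in `]0%R, +oo[) ((f 0 - f x) * (t * weil_kernel (t * x)))%:E)%E.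
  have ft0 x : 0 < x -> (0 <= ((ft 0 - ft x) * weil_kernel x)%:E)%E.
    move=> x0; rewrite lee_fin mulr_ge0 ?(ltW (weil_kernel_gt0 _))//.
    by rewrite /ft mul0r.
  have := ge0_integral_scale_pos t0 mft ft0.
  rewrite -/(log_energy ft) => /(congr1 (fun z => t%:E * z)%E).
  rewrite muleA -EFinM divff ?gt_eqF// mul1e => <-.
  rewrite -ge0_integralZl//; last 3 first.
  - apply/measurable_EFinP; apply: measurable_funM.
      apply: measurable_funTS; apply: measurable_funB => //.
      have := measurable_affine t 0 (acl_measurable ftL).
      by under eq_fun do rewrite addr0.
    exact: mkt.
  - move=> x; rewrite /= in_itv/= andbT => /(mulr_gt0 t0); exact: ft0.
  - by rewrite lee_fin ltW.
  apply: eq_integral => x _; rewrite -EFinM; congr _%:E.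
  by rewrite /ft mul0r [t * x]mulrC mulfK ?gt_eqF//; ring.
rewrite -/ft H.
have ibd : mu.-integrable `]0, +oo[ (EFin \o (fun x => b x + s * (b x + d x))).
  exact: eq_integrable (integrableD mI ib (integrableZl mI s (integrableD mI ib id))).
have sE : fine (log_energy f) +
    s * (fine (log_energy f) + 2 * f 0 * dilation_constant) =
    \int[mu]_(x in `]0, +oo[) (b x + s * (b x + d x)).
  have ibd' : mu.-integrable `]0, +oo[ (EFin \o (fun x => b x + d x)).
    exact: eq_integrable (integrableD mI ib id).
  rewrite RintegralD//; last exact: eq_integrable (integrableZl mI s ibd').
  by rewrite RintegralZl// RintegralD// RintegralZl.
rewrite sE /Rintegral fineK; last exact: integrable_fin_num ibd.
apply: ge0_le_integral => //.
- move=> x; rewrite /= in_itv/= andbT => x0; rewrite lee_fin.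
  by rewrite mulr_ge0// mulr_ge0 ?ltW// weil_kernel_gt0// mulr_gt0.
- apply/measurable_EFinP; apply: measurable_funM.
    by apply: measurable_funTS; apply: measurable_funB => //; exact: acl_measurable fL.
  exact: measurable_funM.
- exact: (measurable_int _ ibd).
- move=> x; rewrite /= in_itv/= andbT => x0; rewrite lee_fin.
  apply: le_trans (ler_wpM2l (D0 x) (weil_kernel_dilate t2 x0)) _.
  rewrite /b /d -/s [4^-1 * x]mulrC mulrDr lerD2l mulrCA ler_wpM2l// mulrDr lerD2l.
  rewrite ler_wpM2r ?expR_ge0//.
  by have := acl_bound fL x; rewrite ler_norml => /andP[? _]; lra.
Qed.

End dilation.

(** * Continuity of the lowest eigenvalue *)

Section weil_lambda_continuity.
Context {R : realType}.
Implicit Types (f : R -> R) (a t e r L : R) (v : R -> R[i]).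

Lemma acl_widen L L' f : L <= L' -> autocorrelation_like L f ->
  autocorrelation_like L' f.
Proof.
by move=> LL' [mf ef sf bf af cf]; split => // x /(le_trans LL'); exact: sf.
Qed.

Lemma fine_log_energy_ge0 L f : autocorrelation_like L f ->
  0 <= fine (log_energy f).
Proof. by move=> fL; rewrite fine_ge0// (log_energy_ge0 fL). Qed.

Lemma log_energy_coercive L : 0 <= L -> exists2 C : R, 0 <= C &
  forall f, autocorrelation_like L f -> (log_energy f < +oo)%E ->
  2 * fine (log_energy f) <= fine (weil_functional f) + C * f 0.
Proof.
move=> L0.
have [N LN] : exists N : nat, expR L <= N%:R.
  by exists (Num.bound (expR L)); rewrite ltW// archi_boundP// expR_ge0.
pose S : R := \sum_(1 <= n < N) 2 * `|von_mangoldt R n / Num.sqrt n%:R|.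
have S0 : 0 <= S by apply: sumr_ge0 => n _; rewrite mulr_ge0.
pose P : R := 4 * L * expR (L / 2).
have P0 : 0 <= P by rewrite !mulr_ge0// expR_ge0.
exists (P + S + `|weil_constant|); first by rewrite !addr_ge0.
move=> f fL foo; rewrite (weil_functionalE fL L0 LN foo).
have f0 := acl_ge0 fL.
have [_] := pole_termP (acl_measurable fL) (acl_bound fL) (acl_support fL) L0.
rewrite -/P ler_norml => /andP[Pf _].
(* Comparison with the zero function bounds [prime_term N f] itself. *)
have := @prime_term_le _ N f (fun=> 0) (f 0).
rewrite [prime_term N (fun=> 0)]big1; last by move=> n _; rewrite addr0 mulr0.
rewrite -/S subr0 ler_norml => Sf.
have /Sf/andP[_ {}Sf] : forall x, `|f x - 0| <= f 0.
  by move=> x; rewrite subr0; exact: acl_bound fL x.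
have : weil_constant * f 0 <= `|weil_constant| * f 0.
  by rewrite ler_wpM2r// ler_norm.
lra.
Qed.

Lemma weil_functional_dilate L e : 0 <= L -> 0 < e -> exists2 d, 0 < d &
  forall t f, `|1 - t| < d -> autocorrelation_like L f ->
  (log_energy f < +oo)%E ->
  [/\ 0 < t, (log_energy (fun x => f (x / t)%R) < +oo)%E &
  fine (weil_functional (fun x => f (x / t))) <=
  fine (weil_functional f) + e * (f 0 + fine (log_energy f))].
Proof.
(* Since [t] will be below [3/2], both [f] and its dilate vanish outside [(-L2, L2)], so one [N] and
   one pole bound serve for both. *)
move=> L0 e0; pose L2 := 2 * L.
have L20 : 0 <= L2 by rewrite mulr_ge0.
have [N LN] : exists N : nat, expR L2 <= N%:R.
  by exists (Num.bound (expR L2)); rewrite ltW// archi_boundP// expR_ge0.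
pose S : R := \sum_(1 <= n < N) 2 * `|von_mangoldt R n / Num.sqrt n%:R|.
have S0 : 0 <= S by apply: sumr_ge0 => n _; rewrite mulr_ge0.
pose P : R := 4 * L2 * expR (L2 / 2).
have P0 : 0 <= P by rewrite !mulr_ge0// expR_ge0.
have K0 := @dilation_constant_ge0 R; set K := dilation_constant in K0.
(* A uniform distance [e1 * (f 0 + E)] changes the pole and prime terms by at most half of the
   allowed error; the [+ 1] keeps the denominator positive. *)
pose e1 := e / (2 * (P + S + 1)).
have e10 : 0 < e1 by rewrite divr_gt0//; lra.
have [d d0 Hd] := log_energy_uniform_modulus e10.
(* For [|x| <= 2 * L] and [t >= 1/2], the displacement [|x / t - x|] is at most [4 * L * |1 - t|],
   which must not exceed [d]. *)
pose d1 := d / (4 * L + 1).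
have d10 : 0 < d1 by rewrite divr_gt0//; lra.
(* The energy counts twice, so its error [8 * |1 - t| * (E + 2 * f 0 * K)] must fit into the other
   half, [e / 2 * (f 0 + E)]. *)
pose d2 := e / (16 * (1 + 2 * K)).
have d20 : 0 < d2 by rewrite divr_gt0//; lra.
exists (Num.min 2^-1 (Num.min d1 d2)); first by rewrite !lt_min d10 d20 invr_gt0 ltr0n.
move=> t f; rewrite !lt_min => /and3P[t2 td1 td2] fL foo.
move: (t2); rewrite ltr_norml => /andP[t2l t2r].
have t0 : 0 < t by lra.
have f0 := acl_ge0 fL.
have E0 := fine_log_energy_ge0 fL.
have ftL := autocorrelation_like_scale t0 fL.
have t2' : 2^-1 <= t by lra.
have Et := log_energy_dilate fL t2' foo.
set ft := fun x => f (x / t) in ftL Et *.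
have ft0 : ft 0 = f 0 by rewrite /ft mul0r.
have ftoo : (log_energy ft < +oo)%E by rewrite (le_lt_trans Et)// ltry.
have fL2 : autocorrelation_like L2 f by apply: acl_widen fL; rewrite /L2; lra.
have ftL2 : autocorrelation_like L2 ft.
  by apply: acl_widen ftL; rewrite /L2 ler_wpM2r//; lra.
set E := fine (log_energy f) in E0 Et *.
have {}Et : fine (log_energy ft) <= E + 4 * `|1 - t| * (E + 2 * f 0 * K).
  rewrite -lee_fin fineK// ge0_fin_numE//; exact: log_energy_ge0 ftL.
have dist x : `|ft x - f x| <= e1 * (f 0 + E).
  have B0 : 0 <= e1 * (f 0 + E) by rewrite mulr_ge0 ?addr_ge0// ltW.
  have [xL|xL] := leP `|x| L2; last first.
    by rewrite (acl_support ftL2 (ltW xL)) (acl_support fL2 (ltW xL)) subrr normr0.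
  rewrite distrC.
  have -> : ft x = f (x + (x / t - x)) by rewrite addrC subrK.
  apply: (Hd L) => //.
  have -> : x / t - x = x * (1 - t) / t by field; rewrite gt_eqF.
  rewrite !normrM normfV (gtr0_norm t0) ler_pdivrMr//.
  have : `|1 - t| * (4 * L + 1) < d by rewrite -ltr_pdivlMr//; lra.
  have := ler_wpM2r (normr_ge0 (1 - t)) xL; rewrite /L2 => H1 H2.
  have : d * 2^-1 <= d * t by rewrite ler_wpM2l// ltW.
  have := normr_ge0 (1 - t); lra.
split => //.
rewrite (weil_functionalE fL2 L20 LN foo) (weil_functionalE ftL2 L20 LN ftoo) ft0 -/E.
have mft : measurable_fun setT (fun x => ft x - f x).
  by apply: measurable_funB; [exact: acl_measurable ftL|exact: acl_measurable fL].
have sup x : L2 <= `|x| -> ft x - f x = 0.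
  by move=> xL; rewrite (acl_support ftL2 xL) (acl_support fL2 xL) subrr.
have [_] := pole_termP mft dist sup L20.
have [if_ _] := pole_termP (acl_measurable fL2) (acl_bound fL2) (acl_support fL2) L20.
have [ift _] := pole_termP (acl_measurable ftL2) (acl_bound ftL2) (acl_support ftL2) L20.
have -> : pole_term (fun x => ft x - f x) = pole_term ft - pole_term f.
  rewrite /pole_term -RintegralB//.
  by apply: eq_Rintegral => x _; rewrite mulrBl.
rewrite -/P ler_norml => /andP[_ HP].
have := prime_term_le N dist; rewrite -/S ler_norml => /andP[HS _].
have : e1 * (f 0 + E) * P + e1 * (f 0 + E) * S <= e / 2 * (f 0 + E).
  have -> : e / 2 = e1 * (P + S + 1) by rewrite /e1; field; rewrite gt_eqF//; lra.
  have : 0 <= e1 * (f 0 + E) by rewrite mulr_ge0 ?addr_ge0// ltW.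
  lra.
have : 2 * (4 * `|1 - t| * (E + 2 * f 0 * K)) <= e / 2 * (f 0 + E).
  have : `|1 - t| * (16 * (1 + 2 * K)) <= e by rewrite -ler_pdivlMr ?ltW//; lra.
  have fE0 : 0 <= f 0 + E by rewrite addr_ge0.
  move=> /(ler_wpM2r fE0).
  have := normr_ge0 (1 - t) => n0.
  have : 0 <= `|1 - t| * (f 0 + 2 * K * E) by rewrite mulr_ge0// addr_ge0// !mulr_ge0.
  lra.
lra.
Qed.

Definition weil_quotients a : set R :=
  [set r | exists v, [/\ weil_form_domain a v, L2normsq v != 0%E &
                         r = fine (weil_form v) / fine (L2normsq v)]].

Lemma weil_lambdaE a : weil_lambda a = inf (weil_quotients a).
Proof. by []. Qed.

(** Divide [weil_functional_dilate] by [f 0]; coercivity bounds the energy over [f 0] by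
    [(r + C) / 2]. Both [C] and [d] serve all [a <= B], so the dilation can be used in either
    direction. *)
Lemma weil_quotients_bound B : 0 <= B -> exists2 C : R, 0 <= C &
  [/\ (forall a r, 0 < a <= B -> weil_quotients a r -> - C <= r) &
  forall e, 0 < e -> exists2 d, 0 < d & forall a t r, 0 < a <= B ->
    `|1 - t| < d -> weil_quotients a r ->
    exists2 r', weil_quotients (t * a) r' & r' <= r + e * (1 + (r + C) / 2)].
Proof.
move=> B0; have L0 : 0 <= 2 * B by rewrite mulr_ge0.
have [C C0 HC] := log_energy_coercive L0.
have key a v : 0 < a <= B -> weil_form_domain a v -> L2normsq v != 0%E ->
    let f := weil_autocorrelation v in
    [/\ autocorrelation_like (2 * B) f, (log_energy f < +oo)%E, 0 < f 0,
      weil_form v = weil_functional f & fine (L2normsq v) = f 0].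
  move=> /andP[a0 aB] [va vfin] vn0 f.
  have fa := weil_autocorrelation_like va.
  have fB : autocorrelation_like (2 * B) f by apply: acl_widen fa; lra.
  move: vfin vn0; rewrite (weil_formE va) (L2normsqE va) -/f => vfin vn0.
  split => //; first exact/(weil_functional_fin_num fB L0).
  by rewrite lt0r (acl_ge0 fB) andbT; apply: contraNneq vn0 => ->.
exists C => //; split.
  move=> a r aB [v [va vn0 ->]].
  have [fB foo f0 -> ->] := key a v aB va vn0.
  rewrite ler_pdivlMr// mulNr.
  have := HC _ fB foo; have := fine_log_energy_ge0 fB; lra.
move=> e e0; have [d d0 Hd] := weil_functional_dilate L0 e0.
exists d => // a t r aB td [v [va vn0 ->]].
have [fB foo f0 WE NE] := key a v aB va vn0.
set f := weil_autocorrelation v in fB foo f0 WE NE.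
have [t0 ftoo Ht] := Hd t f td fB foo.
have tva := L2_interval_dilate t0 va.1.
have ftE : weil_autocorrelation (dilate t v) = (fun x => f (x / t)).
  by rewrite (weil_autocorrelation_dilate t0 va.1).
have ftB := autocorrelation_like_scale t0 fB.
have N'E : L2normsq (dilate t v) = (f 0)%:E by rewrite (L2normsqE tva) ftE mul0r.
have W'E : weil_form (dilate t v) = weil_functional (fun x => f (x / t)).
  by rewrite (weil_formE tva) ftE.
have dva : weil_form_domain (t * a) (dilate t v).
  split; first exact: tva.
  rewrite W'E; apply: (weil_functional_fin_num ftB _).2 ftoo.
  by rewrite mulr_ge0// ltW.
have N'0 : L2normsq (dilate t v) != 0%E by rewrite N'E eqe gt_eqF.
exists (fine (weil_form (dilate t v)) / fine (L2normsq (dilate t v))).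
  by exists (dilate t v); split; [exact: dva|exact: N'0|reflexivity].
rewrite W'E N'E WE NE /= ler_pdivrMr//; apply: le_trans Ht _.
have -> : (fine (weil_functional f) / f 0 +
    e * (1 + (fine (weil_functional f) / f 0 + C) / 2)) * f 0 =
    fine (weil_functional f) + e * (f 0 + (fine (weil_functional f) + C * f 0) / 2).
  by field; rewrite gt_eqF.
by rewrite lerD2l ler_pM2l// lerD2l; have := HC f fB foo; lra.
Qed.

End weil_lambda_continuity.

Theorem theorem1p3 (R : realType) :
  {within `]0, +oo[, continuous (@weil_lambda R)}.
Proof.
apply: continuous_in_subspaceT => a0; rewrite inE/= in_itv/= andbT => a00.
apply/cvgrPdist_le => eta eta0.
(* Both [a0] and all nearby [a] lie in []0, 2 * a0]], hence share the same constants. *)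
have B0 : 0 <= 2 * a0 by rewrite mulr_ge0// ltW.
have [C C0 [Qlb Qdil]] := weil_quotients_bound B0.
pose l0 := weil_lambda a0.
have lb a : 0 < a <= 2 * a0 -> lbound (weil_quotients a) (- C).
  by move=> aB r; exact: Qlb.
(* [M] also has to dominate [1 + (weil_lambda a + C) / 2]: with [e <= 1], the upper estimate of
   [weil_lambda a] bounds this by [3/2 + 3/4 * (l0 + C)]. *)
pose M := 2 + `|l0 + C|.
have M0 : 0 < M by rewrite ltr_pwDl.
pose e := Num.min 1 (eta / M).
have e0 : 0 < e by rewrite lt_min ltr01 divr_gt0.
have e1 : e <= 1 by rewrite ge_min lexx.
have eM : e * M <= eta by rewrite -ler_pdivlMr// ge_min lexx orbT.
have [d d0 Hd] := Qdil e e0.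
have step a a' : 0 < a <= 2 * a0 -> 0 < a' <= 2 * a0 -> `|1 - a' / a| < d ->
    weil_quotients a !=set0 -> weil_quotients a' !=set0 /\
    weil_lambda a' <= weil_lambda a + e * (1 + (weil_lambda a + C) / 2).
  move=> aB a'B aa' Qa.
  have a'E : a' / a * a = a' by rewrite mulfVK// gt_eqF//; case/andP: aB.
  have H r : weil_quotients a r ->
      exists2 r', weil_quotients a' r' & r' <= r + e * (1 + (r + C) / 2).
    by move=> /(Hd a _ r aB aa'); rewrite a'E.
  split; first by case: Qa => r /H[r' Qr' _]; exists r'.
  (* The map [r |-> r + e * (1 + (r + C) / 2)] is affine with slope [1 + e / 2 > 0]; its inverse at
     [weil_lambda a'] is a lower bound of the quotients for [a]. *)
  suff : (weil_lambda a' - e * (1 + C / 2)) / (1 + e / 2) <= weil_lambda a.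
    by rewrite ler_pdivrMr; [lra|lra].
  apply: lb_le_inf => // r /H[r' Qr' rr'].
  have : weil_lambda a' <= r' by apply: ge_inf => //; exists (- C); exact: lb.
  by rewrite ler_pdivrMr; [lra|lra].
have a0B : 0 < a0 <= 2 * a0 by rewrite a00/=; lra.
(* The first bound keeps [a] between [a0 / 2] and [3 * a0 / 2]. The second puts [a / a0] and, since
   [a > a0 / 2], also [a0 / a] within [d] of [1]. *)
apply/nbhs_ballP; exists (Num.min (a0 / 2) (d * a0 / 2)) => /=.
  by rewrite lt_min !divr_gt0// mulr_gt0.
move=> a; rewrite /ball/= lt_min => /andP[ad1 ad2].
move: (ad1); rewrite ltr_norml => /andP[? ?].
have aB : 0 < a <= 2 * a0 by apply/andP; split; lra.
have a_gt0 : 0 < a by case/andP: aB.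
have d1 : `|1 - a / a0| < d.
  have -> : 1 - a / a0 = (a0 - a) / a0 by field; rewrite gt_eqF.
  rewrite normrM normfV (gtr0_norm a00) ltr_pdivrMr//.
  have : 0 < d * a0 by rewrite mulr_gt0.
  lra.
have d2 : `|1 - a0 / a| < d.
  have -> : 1 - a0 / a = (a - a0) / a by field; rewrite gt_eqF.
  rewrite normrM normfV (gtr0_norm a_gt0) ltr_pdivrMr// distrC.
  apply: lt_le_trans ad2 _; rewrite -mulrA ler_pM2l//; lra.
have [Q0|Q0] := pselect (weil_quotients a0 !=set0); last first.
  (* Dilations show that the form domains are trivial together; in that case
     [weil_lambda] is the junk value [inf set0 = 0] on both sides. *)
  have Qa : ~ (weil_quotients a !=set0).
    by move=> /(step a a0 aB a0B d2)[].
  move: Q0 Qa => /set0P/negP/negPn/eqP Q0 /set0P/negP/negPn/eqP Qa.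
  by rewrite !weil_lambdaE Q0 Qa subrr normr0 ltW.
have [Qa Ha] := step a0 a a0B aB d1 Q0.
have [_ Ha0] := step a a0 aB a0B d2 Qa.
have l0C : 0 <= l0 + C.
  by rewrite -[C]opprK subr_ge0; apply: lb_le_inf => //; exact: lb.
have laC : 0 <= weil_lambda a + C.
  by rewrite -[C]opprK subr_ge0; apply: lb_le_inf => //; exact: lb.
rewrite -/l0 in Ha Ha0 *.
apply: le_trans eM; rewrite /M [`|l0 + C|]ger0_norm// ler_norml; apply/andP; split; nra.
Qed.
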